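(* Let $(a_n)_{n\in\mathbb{N}}$ be a bounded sequence of real numbers and let $\ell\in\mathbb{R}$. The following are equivalent: (1) $\liminf_{n\to\infty}a_n=\ell$. (2) $(\mathcal{U}\otimes\mathcal{V})\text{-}\lim_{(n,m)}\left(\min_{n\le k\le m}a_k\right)=\ell$ for all non-principal ultrafilters $\mathcal{U}$ and $\mathcal{V}$ on $\mathbb{N}$. (3) For every non-principal ultrafilter $\mathcal{U}$ on $\mathbb{N}$ there exists a non-principal ultrafilter $\mathcal{V}$ on $\mathbb{N}$ such that $(\mathcal{U}\otimes\mathcal{V})\text{-}\lim_{(n,m)}\left(\min_{n\le k\le m}a_k\right)=\ell$. Similarly, the following are equivalent to each other: (4) $\limsup_{n\to\infty}a_n=\ell$. (5) $(\mathcal{U}\otimes\mathcal{V})\text{-}\lim_{(n,m)}\left(\max_{n\le k\le m}a_k\right)=\ell$ for all non-principal ultrafilters $\mathcal{U}$ and $\mathcal{V}$ on $\mathbb{N}$. (6) For every non-principal ultrafilter $\mathcal{U}$ on $\mathbb{N}$ there exists a non-principal ultrafilter $\mathcal{V}$ on $\mathbb{N}$ such that $(\mathcal{U}\otimes\mathcal{V})\text{-}\lim_{(n,m)}\left(\max_{n\le k\le m}a_k\right)=\ell$.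
   Context: For ultrafilters $\mathcal{U},\mathcal{V}$ on $\mathbb{N}$, the tensor product $\mathcal{U}\otimes\mathcal{V}$ is the ultrafilter on $\mathbb{N}\times\mathbb{N}$ defined by: $X\in\mathcal{U}\otimes\mathcal{V}$ if and only if $\{n\in\mathbb{N}\mid\{m\in\mathbb{N}\mid (n,m)\in X\}\in\mathcal{V}\}\in\mathcal{U}$. For an ultrafilter $\mathcal{W}$ on a set $I$, a real sequence $(x_i\mid i\in I)$ and $\ell\in\mathbb{R}$, one writes $\mathcal{W}\text{-}\lim_i x_i=\ell$ if $\{i\in I\mid x_i\in U\}\in\mathcal{W}$ for every neighborhood $U$ of $\ell$. Convention: for $n>m$, where the range $n\le k\le m$ is empty, the expressions $\min_{n\le k\le m}a_k$ and $\max_{n\le k\le m}a_k$ are taken to be $0$. *)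

(* Defs.v *)
From mathcomp Require Import all_boot all_order all_algebra.
From mathcomp Require Import all_classical all_reals all_analysis.
Set Implicit Arguments.
Unset Strict Implicit.
Unset Printing Implicit Defensive.
Import Order.TTheory GRing.Theory Num.Theory.
Import numFieldNormedType.Exports.
Local Open Scope classical_set_scope.
Local Open Scope ring_scope.

Definition nonprincipal_ultrafilter (T : Type) (U : set_system T) : Prop :=
  UltraFilter U /\ forall x : T, U <> principal_filter x.

(* Not the library's [filter_prod]: that is the product filter, generated by
   rectangles, which is in general strictly coarser and not an ultrafilter. *)
Definition filter_tensor (S T : Type) (U : set_system S) (V : set_system T) :
    set_system (S * T) :=
  [set X | U [set n | V [set m | X (n, m)]]].

Lemma filter_tensor_ultra (S T : Type) (U : set_system S) (V : set_system T) :
  UltraFilter U -> UltraFilter V -> UltraFilter (filter_tensor U V).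
Proof.
move=> UU UV.
have PU := @ultra_proper _ _ UU; have PV := @ultra_proper _ _ UV.
have PW : ProperFilter (filter_tensor U V).
  split.
    rewrite /filter_tensor /= => U0; apply: (@filter_not_empty _ U).
    apply: filterS U0 => n V0; exact: (@filter_not_empty _ V).
  split.
  - by rewrite /filter_tensor /=; apply: filterS (@filterT _ U _) => n _; exact: filterT.
  - move=> P Q; rewrite /filter_tensor /= => UP UQ.
    by apply: filterS (filterI UP UQ) => n [VP VQ]; exact: filterI.
  - move=> P Q PQ; rewrite /filter_tensor /=.
    by apply: filterS => n; apply: filterS => m; exact: PQ.
split=> // G PG WG; apply/seteqP; split=> // X GX.
have [//|UC] := in_ultra_setVsetC [set n | V [set m | X (n, m)]] UU.
have WC : filter_tensor U V (~` X).
  apply: filterS UC => n nVX.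
  by have [/nVX//|] := in_ultra_setVsetC [set m | X (n, m)] UV.
have G0 : G set0 by rewrite -(setICr X); exact: filterI GX (WG _ WC).
by have := @filter_not_empty _ G PG G0.
Qed.

(* For [n <= m] the neutral argument [a n] is itself one of the terms, so it
   does not affect the minimum or maximum over the integers [n <= k <= m]. *)
Definition interval_min (R : realType) (a : R^nat) (p : nat * nat) : R :=
  if (p.1 <= p.2)%N then \big[Num.min/a p.1]_(p.1 <= k < p.2.+1) a k else 0.

Definition interval_max (R : realType) (a : R^nat) (p : nat * nat) : R :=
  if (p.1 <= p.2)%N then \big[Num.max/a p.1]_(p.1 <= k < p.2.+1) a k else 0.

(* Main.v *)
Require Import Defs.
From mathcomp Require Import all_boot all_order all_algebra.
From mathcomp Require Import all_classical all_reals all_analysis.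
Import Order.TTheory GRing.Theory Num.Theory.
Import numFieldNormedType.Exports.
Local Open Scope classical_set_scope.
Local Open Scope ring_scope.

(** A limit along [filter_tensor U V] may be computed as an iterated limit:
    [V] in the second variable, then [U] in the first.  Every non-principal
    ultrafilter on [nat] refines the Frechet filter [\oo], so an ordinary limit
    along [\oo] is also a limit along [U] and along [V].  For the function
    [interval_min a] both ordinary limits exist: when [n] is fixed and [m]
    grows, the minimum of [a] over [n <= k <= m] tends to the infimum of the
    tail of [a] from [n] on, and the lower limit of [a] is by
    definition the limit of these infima.
    Hence [interval_min a] converges to the lower limit along every tensor
    product of non-principal ultrafilters.  Since limits of reals along a
    proper filter are unique and a non-principal ultrafilter exists, any of
    the three conditions pins down [l].

    This argument, [tfae_tensor_lim], uses only the two ordinary limits; the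
    statement for [interval_max] and the upper limit is another instance,
    whose inner limit comes from that of [- a] by duality. *)

(** Containing a singleton would force [U] to extend, hence to equal, the
    principal ultrafilter at that point. *)
Lemma nonprincipal_setC1 (T : Type) (U : set_system T) (x : T) :
  nonprincipal_ultrafilter U -> U (~` [set x]).
Proof.
move=> [UU Unp]; have PU := @ultra_proper _ _ UU.
have [Ux|//] := in_ultra_setVsetC [set x] UU.
case: (Unp x); apply: (max_filter (UltraFilter := principal_filter_ultra x)).
by move=> A /principal_filterP Ax; apply: filterS Ux => _ ->.
Qed.

(** A tail is a finite intersection of complements of singletons. *)
Lemma nonprincipal_cvg_infty (U : set_system nat) :
  nonprincipal_ultrafilter U -> U --> \oo.
Proof.
move=> npU; have [UU _] := npU; have PU := @ultra_proper _ _ UU.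
move=> A [N _ NA]; suff: U [set n | (N <= n)%N] by exact: filterS.
elim: N {A NA} => [|N IHN]; first exact: filterE.
apply: filterS2 IHN (nonprincipal_setC1 _ U N npU) => n /= Nn neqnN.
by rewrite ltn_neqAle Nn andbT; apply/eqP => /esym.
Qed.

Lemma exists_nonprincipal_nat :
  exists U : set_system nat, nonprincipal_ultrafilter U.
Proof.
have [U [UU ooU]] := ultraFilterLemma eventually_filter.
exists U; split=> // x Ux.
have /ooU : \oo [set n | (x < n)%N] by exists x.+1.
by rewrite Ux => /principal_filterP /=; rewrite ltnn.
Qed.

(** The inner limit lands in a neighbourhood of the outer one because every
    neighbourhood of [l] is a neighbourhood of all points close to [l]. *)
Lemma cvg_filter_tensor {S T : Type} {X : topologicalType}
    {U : set_system S} {V : set_system T} {FU : Filter U}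
    (f : S * T -> X) (g : S -> X) (l : X) :
  (forall n, f (n, m) @[m --> V] --> g n) -> g @ U --> l ->
  f @ filter_tensor U V --> l.
Proof.
move=> fg gl B /nbhs_interior /gl gB.
rewrite /nbhs /= /filter_tensor /=.
by apply: (filterS (F := U)) gB => n; exact: fg.
Qed.

Lemma tfae_tensor_lim (X : topologicalType) (f : nat * nat -> X)
    (g : nat -> X) (L l : X) (hX : hausdorff_space X)
    (fg : forall n, f (n, m) @[m --> \oo] --> g n) (gL : g @ \oo --> L) :
  [<-> L = l;
       forall U V : set_system nat,
         nonprincipal_ultrafilter U -> nonprincipal_ultrafilter V ->
         f @ filter_tensor U V --> l;
       forall U : set_system nat, nonprincipal_ultrafilter U ->
         exists V : set_system nat, nonprincipal_ultrafilter V /\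
           f @ filter_tensor U V --> l].
Proof.
have fL (U V : set_system nat) : nonprincipal_ultrafilter U ->
    nonprincipal_ultrafilter V -> f @ filter_tensor U V --> L.
  move=> npU npV; have FU := @ultra_proper _ _ npU.1.
  apply: (@cvg_filter_tensor _ _ _ _ _ _ _ g) => [n|].
    by apply: cvg_trans (fg n); apply: cvg_app; exact: nonprincipal_cvg_infty.
  by apply: cvg_trans gL; apply: cvg_app; exact: nonprincipal_cvg_infty.
tfae.
- by move=> <-.
- by move=> fl U npU; exists U; split=> //; exact: fl.
- have [U npU] := exists_nonprincipal_nat => /(_ U npU)[V [npV fl]].
  have PW := @ultra_proper _ _ (filter_tensor_ultra npU.1 npV.1).
  exact: (cvg_unique hX (fL U V npU npV) fl).
Qed.

(** A term within [e] of the infimum of the tail enters the minimum as soon as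
    [m] exceeds its index, and the minimum never drops below that infimum. *)
Lemma cvg_interval_min (R : realType) (a : R^nat) (n : nat) :
  has_lbound (range a) -> interval_min a (n, m) @[m --> \oo] --> infs a n.
Proof.
move=> [c ca].
have lb : has_inf (sdrop a n).
  split; first by exists (a n); exists n => /=.
  by exists c => _ [k _ <-]; apply: ca; exists k.
apply/cvgrPdist_lt => e e0.
have [_ [k /= nk <-] ake] := inf_adherent e0 lb.
near=> m.
have km : (k <= m)%N by near: m; exact: nbhs_infty_ge.
rewrite /interval_min /= (leq_trans nk km) distrC ger0_norm ?subr_ge0.
  rewrite ltrBlDl; apply: le_lt_trans ake.
  by apply: (ge_bigmin_seq _ k); rewrite // mem_index_iota nk ltnS.
have inf_le j : (n <= j)%N -> infs a n <= a j.
  by move=> nj; apply: ge_inf; [exact: lb.2|exists j].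
rewrite big_seq; apply: (big_ind (fun x => infs a n <= x)) => [|x y ax ay|j].
- exact: inf_le.
- by rewrite le_min ax.
- by rewrite mem_index_iota => /andP[nj _]; exact: inf_le.
Unshelve. all: by end_near.
Qed.

Lemma interval_maxE (R : realType) (a : R^nat) :
  interval_max a = - interval_min (- a).
Proof.
apply/funext => -[n m]; rewrite fctE /interval_max /interval_min /=.
case: ifP => _; last by rewrite oppr0.
rewrite (big_morph -%R (@oppr_min R) (erefl _)) opprK.
by apply: eq_bigr => k _; rewrite opprK.
Qed.

Lemma cvg_interval_max (R : realType) (a : R^nat) (n : nat) :
  has_ubound (range a) -> interval_max a (n, m) @[m --> \oo] --> sups a n.
Proof.
move=> [c ac]; rewrite interval_maxE.
have -> : sups a n = - infs (- a) n.
  by rewrite (infsN a) fctE opprK.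
apply: cvgN; apply: cvg_interval_min.
by exists (- c) => _ [k _ <-]; rewrite lerN2; apply: ac; exists k.
Qed.

Theorem proposition4p3 (R : realType) (a : R^nat) (l : R)
    (ha : bounded_fun a) :
  [<-> limn_inf a = l;
       forall U V : set_system nat,
         nonprincipal_ultrafilter U -> nonprincipal_ultrafilter V ->
         interval_min a @ filter_tensor U V --> l;
       forall U : set_system nat, nonprincipal_ultrafilter U ->
         exists V : set_system nat, nonprincipal_ultrafilter V /\
           interval_min a @ filter_tensor U V --> l]
  /\
  [<-> limn_sup a = l;
       forall U V : set_system nat,
         nonprincipal_ultrafilter U -> nonprincipal_ultrafilter V ->
         interval_max a @ filter_tensor U V --> l;
       forall U : set_system nat, nonprincipal_ultrafilter U ->
         exists V : set_system nat, nonprincipal_ultrafilter V /\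
           interval_max a @ filter_tensor U V --> l].
Proof.
have aub := bounded_fun_has_ubound ha; have alb := bounded_fun_has_lbound ha.
split.
- apply: (tfae_tensor_lim _ _ (infs a)); first exact: Rhausdorff.
  + by move=> n; exact: cvg_interval_min.
  + by rewrite limn_infE//; exact: cvg_infs_sup.
- apply: (tfae_tensor_lim _ _ (sups a)); first exact: Rhausdorff.
  + by move=> n; exact: cvg_interval_max.
  + by rewrite limn_supE//; exact: cvg_sups_inf.
Qed.
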